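(* There exist $r\in\mathbb{N}$ and $\epsilon>0$ such that $\mathrm{encost}_{r,\epsilon}(\mathbb{F})=\infty$. Indeed, for these $r$ and $\epsilon$, \[\sup\{\mathrm{encost}_{r,\epsilon}(\Theta):\Theta\text{ is a finite }4\text{-regular directed graph}\}=\infty.\]
   Context: $\mathbb{F}$ is the free group of rank two with fixed free generators $a,b$, identity $e$, word length $|\cdot|$, and $\mathbb{B}_r=\{g\in\mathbb{F}:|g|\le r\}$. For $d\in\mathbb{N}$ and finite $F\subseteq\mathbb{F}$, a function $\mathsf{C}:F\to\mathrm{Mat}_{d\times d}(\mathbb{C})$ is positive definite if $\sum_{g,h\in S}\alpha(h)^\ast\mathsf{C}(h^{-1}g)\alpha(g)\ge 0$ for every $S\subseteq\mathbb{F}$ with $S^{-1}S\subseteq F$ and every $\alpha:S\to\mathbb{C}^d$; it is strictly positive definite if moreover equality holds only for $\alpha\equiv 0$; it is normalized if $\mathsf{C}(e)=\mathbf{I}_d$. A function on all of $\mathbb{F}$ is (strictly) positive definite if all its restrictions to finite sets are. $\mathrm{NSPD}(r,d)$ denotes the set of normalized strictly positive definite functions $\mathbb{B}_r\to\mathrm{Mat}_{d\times d}(\mathbb{C})$. Realizations: for $\mathsf{C}\in\mathrm{NSPD}(2s,d)$ there is a Hilbert space $\mathscr{X}(\mathsf{C})$ and $\Phi_\mathsf{C}:\mathbb{B}_s\to\mathscr{X}(\mathsf{C})^d$ with $\langle\Phi_\mathsf{C}(g)_j,\Phi_\mathsf{C}(h)_k\rangle=\mathsf{C}(h^{-1}g)_{j,k}$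 for $g,h\in\mathbb{B}_s$, $j,k\in[d]$, whose coordinates span $\mathscr{X}(\mathsf{C})$. For $\mathsf{C},\mathsf{D}\in\mathrm{NSPD}(2s,d)$ the transport operator $t[\mathsf{C},\mathsf{D}]$ is the linear map sending $\sum_{g\in\mathbb{B}_s}\sum_j\alpha(g)_j\Phi_\mathsf{C}(g)_j$ to $\sum_{g\in\mathbb{B}_s}\sum_j\alpha(g)_j\Phi_\mathsf{D}(g)_j$, and the relative energy $\mathfrak{e}(\mathsf{C},\mathsf{D})$ is the square of its operator norm (relative energies of functions in $\mathrm{NSPD}(r,d)$ are understood via this definition with realizations indexed by the ball $\mathbb{B}_s$ satisfying $\mathbb{B}_s^{-1}\mathbb{B}_s\subseteq\mathbb{B}_r$ as in the paper). For strictly positive definite $\mathsf{C},\mathsf{D}$ on $\mathbb{F}$, $\mathfrak{e}(\mathsf{C},\mathsf{D})=\sup_r\mathfrak{e}(\mathsf{C}\upharpoonright\mathbb{B}_r,\mathsf{D}\upharpoonright\mathbb{B}_r)$ (possibly $\infty$). A $d$-dimensional radius-$r$ configuration over a finite directed graph $\Theta=(V,E)$ is a family $\mathbf{C}=(\mathsf{C}_v)_{v\in V}$ in $\mathrm{NSPD}(r,d)$. For $\epsilon>0$, $\mathrm{encost}_\epsilon(\mathbf{C})$ is the infimum of all $M\in[1,\infty)$ such that there exist positive definite $\hat{\mathsf{C}}_v:\mathbb{F}\to\mathrm{Mat}_{d\times d}(\mathbb{C})$ with $\max(\mathfrak{e}(\mathsf{C}_v,\hat{\mathsf{C}}_v\upharpoonright\mathbb{B}_r),\mathfrak{e}(\hat{\mathsf{C}}_v\upharpoonright\mathbb{B}_r,\mathsf{C}_v))\le1+\epsilon$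 for all $v\in V$ and $\mathfrak{e}(\hat{\mathsf{C}}_v,\hat{\mathsf{C}}_w)-1\le M(\mathfrak{e}(\mathsf{C}_v,\mathsf{C}_w)-1)$ for all $(v,w)\in E$ (with $\inf\emptyset=\infty$). $\mathrm{encost}_{r,\epsilon}(\Theta)=\sup_\mathbf{C}\mathrm{encost}_\epsilon(\mathbf{C})$ over all $d$ and all $d$-dimensional radius-$r$ configurations over $\Theta$, and $\mathrm{encost}_{r,\epsilon}(\mathbb{F})=\sup_\Theta\mathrm{encost}_{r,\epsilon}(\Theta)$ over all finite directed graphs $\Theta$. A 4-regular directed graph is one in which every vertex has total degree 4 (in the paper's construction: one outgoing and one incoming edge for each of two labels). *)

(* Defs.v *)
From HB Require Import structures.
From mathcomp Require Import all_boot all_order all_algebra.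
From mathcomp Require Import complex.
From mathcomp Require Import boolp classical_sets reals constructive_ereal ereal.
Set Implicit Arguments. Unset Strict Implicit. Unset Printing Implicit Defensive.
Import Order.TTheory GRing.Theory Num.Theory.
Local Open Scope ring_scope.
Local Open Scope classical_set_scope.

(* A letter (gen, inv): gen = false is a, gen = true is b; inv = true means
   the inverse letter. *)
Definition letter := (bool * bool)%type.
Definition word := seq letter.
Definition inv_letter (x : letter) : letter := (x.1, ~~ x.2).

(* reduced words = elements of F; the empty word is the identity e *)
Definition reduced (w : word) : bool := sorted (fun x y => y != inv_letter x) w.

Definition red_cons (x : letter) (w : word) : word :=
  if w is y :: w' then (if y == inv_letter x then w' else x :: w) else [:: x].
Definition fmul (u v : word) : word := foldr red_cons v u.
Definition finv (w : word) : word := rev (map inv_letter w).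
Definition wlen (w : word) : nat := size w.

Fixpoint words (n : nat) : seq word :=
  if n is n'.+1 then [seq x :: w | x <- [:: (false,false); (false,true);
                                           (true,false); (true,true)],
                                   w <- words n']
  else [:: [::]].
Definition ball (s : nat) : seq word :=
  [seq w <- flatten [seq words n | n <- iota 0 s.+1] | reduced w].

Section Energy.
Variable R : realType.
Local Notation C := R[i].

(* matrix-valued functions on F (only their values on the relevant finite
   set matter); d x d complex matrices *)
Definition mfun (d : nat) := word -> 'M[C]_d.

Definition hform d (Cf : mfun d) (S : seq word) (alpha : word -> 'I_d -> C) : C :=
  \sum_(g <- S) \sum_(h <- S) \sum_(j < d) \sum_(k < d)
     (alpha h k)^* * Cf (fmul (finv h) g) k j * alpha g j.

Definition admissible (r : nat) (S : seq word) : Prop :=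
  uniq S /\ all reduced S /\
  (forall g h, g \in S -> h \in S -> wlen (fmul (finv h) g) <= r)%N.

Definition pd_on d (r : nat) (Cf : mfun d) : Prop :=
  forall S alpha, admissible r S -> 0 <= hform Cf S alpha.
Definition spd_on d (r : nat) (Cf : mfun d) : Prop :=
  pd_on r Cf /\
  forall S alpha, admissible r S -> hform Cf S alpha = 0 ->
    forall g, g \in S -> forall j, alpha g j = 0.

Definition pd_full d (Cf : mfun d) : Prop :=
  forall S alpha, uniq S -> all reduced S -> 0 <= hform Cf S alpha.

Definition nspd d (r : nat) (Cf : mfun d) : Prop :=
  Cf [::] = 1%:M /\ spd_on r Cf.

(* Relative energy for functions on B_r, realizations indexed by B_s with
   s = r/2 (floor).  The squared operator norm of the transport operator
   t[C,D] : sum alpha Phi_C |-> sum alpha Phi_D, with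
   ||sum alpha Phi_C||^2 = hform C (ball s) alpha, is the supremum of the
   ratios; if the map is not well defined (a vector with zero C-norm and
   nonzero D-norm) the value is +oo. *)
Definition energy_r d (r : nat) (Cf Df : mfun d) : \bar R :=
  ereal_sup ([set 0%E] `|`
    [set x | exists alpha : word -> 'I_d -> C,
       let qc := complex.Re (hform Cf (ball r./2) alpha) in
       let qd := complex.Re (hform Df (ball r./2) alpha) in
       (0 < qc /\ x = (qd / qc)%:E) \/ (qc = 0 /\ 0 < qd /\ x = +oo%E)]).

Definition energy_full d (Cf Df : mfun d) : \bar R :=
  ereal_sup [set energy_r r Cf Df | r in [set: nat]].

Definition encost d (V : finType) (E : rel V) (r : nat) (eps : R)
    (Cs : V -> mfun d) : \bar R :=
  ereal_inf [set M%:E | M in [set M : R | 1 <= M /\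
    exists Chat : V -> mfun d,
      (forall v, pd_full (Chat v)) /\
      (forall v, energy_r r (Cs v) (Chat v) <= (1 + eps)%:E /\
                 energy_r r (Chat v) (Cs v) <= (1 + eps)%:E)%E /\
      (forall v w, E v w ->
         energy_full (Chat v) (Chat w) - 1%E <=
           M%:E * (energy_r r (Cs v) (Cs w) - 1%E))%E]].

Definition encost_graph (V : finType) (E : rel V) (r : nat) (eps : R) : \bar R :=
  ereal_sup [set x | exists d (Cs : V -> mfun d),
                      (forall v, nspd r (Cs v)) /\ x = encost E r eps Cs].

Definition encost_F (r : nat) (eps : R) : \bar R :=
  ereal_sup [set x | exists (V : finType) (E : rel V), x = encost_graph E r eps].

End Energy.

Definition four_regular (V : finType) (E : rel V) : Prop :=
  forall v : V, (#|[set w | E v w]| + #|[set u | E u v]| = 4)%N.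

(* Main.v *)
Require Import Defs.
From HB Require Import structures.
From mathcomp Require Import all_boot all_order all_algebra.
From mathcomp Require Import complex.
From mathcomp Require Import boolp classical_sets reals constructive_ereal ereal.
From mathcomp Require Import ring lra.
Import Order.TTheory GRing.Theory Num.Theory.
Local Open Scope ring_scope.
Local Open Scope classical_set_scope.

(** Already one-dimensional configurations of radius 2 have unbounded cost, with
    [eps = 1].  Let [z] be a primitive N-th root of unity and perturb the
    character [chi_k] of F sending [a] to [z ^+ k] and [b] to [1] into
    [C_k = (1 - h) chi_k + h delta_e].  The relative energies of the [C_k] are at
    most [32 / h], so extensions of cost [M] satisfy [Q_k <= (32 M / h) Q_0] for
    the quadratic forms [Q_k] that they induce on polynomials in [a].  Since
    [Q_k] is close to [C_k] on the ball of radius 1, it is concentrated near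
    [z ^+ k] with variance of order [h].  The Lagrange polynomials [b_k] of the
    N-th roots of unity satisfy [\sum_k |b_k|^2 = 1] on the unit circle, whence
    [Q_0 (1 - X) = \sum_k Q_0 (b_k (1 - X))]; each summand is at least
    [h / (32 M)] times [Q_k (b_k (1 - X))], which is about [|1 - z ^+ k|^2].
    Hence [Q_0 (1 - X)] is at least of order [h N / M], whereas it is [O(h)]
    because [Q_0] is close to [C_0]; so [M] is at least of order [N].  Only the
    edges from 0 to [k] matter, and giving the same function to all vertices of a
    directed cycle turns this star into a 4-regular graph. *)

Local Notation ball := Defs.ball.
Local Notation finv := Defs.finv.

(** * The free group *)

Lemma inv_letterK : involutive inv_letter.
Proof. by case=> g i; rewrite /inv_letter /= negbK. Qed.

Lemma red_cons_reduced x w : reduced w -> reduced (red_cons x w).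
Proof.
case: w => [|y w] //=; case: ifP => [_|/negbT ynx].
  by rewrite /reduced /=; case: w => //= z w /andP[].
by rewrite /reduced /= ynx.
Qed.

Lemma red_cons_id x w : reduced (x :: w) -> red_cons x w = x :: w.
Proof. by case: w => //= y w; rewrite /reduced /= => /andP[/negbTE ->]. Qed.

Lemma red_consVK x w :
  reduced w -> red_cons x (red_cons (inv_letter x) w) = w.
Proof.
case: w => [_|y w rw] /=; first by rewrite eqxx.
rewrite inv_letterK; case: eqP => [yx|_] /=; last by rewrite eqxx.
by rewrite -yx red_cons_id.
Qed.

Lemma fmul_finv_cons x h g :
  fmul (finv (x :: h)) g =
  fmul (finv h) (red_cons (inv_letter x) g).
Proof. by rewrite /fmul /finv /= rev_cons -cats1 foldr_cat. Qed.

Lemma fmul_finv_cancel x h g : reduced (x :: g) ->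
  fmul (finv (x :: h)) (x :: g) = fmul (finv h) g.
Proof. by rewrite fmul_finv_cons /= inv_letterK eqxx. Qed.

Lemma fmul_finv_id g : fmul (finv g) g = [::].
Proof. by elim: g => // x g IH; rewrite fmul_finv_cons /= inv_letterK eqxx. Qed.

(** On reduced words prepending [x] undoes prepending its inverse, so the letters of [h] can be
    moved across one at a time. This later isolates the diagonal in the form of a delta function. *)
Lemma fmul_finv_eq1 g h : reduced g -> reduced h ->
  (fmul (finv h) g == [::]) = (g == h).
Proof.
move=> rg rh; apply/eqP/eqP => [|->]; last exact: fmul_finv_id.
elim: h g rg rh => [//|x h IH] g rg rh; rewrite fmul_finv_cons => e.
have rh' : reduced h by move: rh; rewrite /reduced /=; case: (h) => //= ? ? /andP[].
have gh := IH _ (red_cons_reduced (inv_letter x) g rg) rh' e.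
by rewrite -(red_consVK x g rg) gh red_cons_id.
Qed.

Definition apow (i : nat) : word := nseq i (false, false).

Lemma apow_inj : injective apow.
Proof. by move=> i j /(congr1 size); rewrite !size_nseq. Qed.

Lemma reduced_apow i : reduced (apow i).
Proof. by case: i => //; elim=> //= i; rewrite /reduced /= => ->. Qed.

Lemma fmul_finv_apowS i j :
  fmul (finv (apow i.+1)) (apow j.+1) = fmul (finv (apow i)) (apow j).
Proof. exact: fmul_finv_cancel (reduced_apow j.+1). Qed.

Lemma words_succ n : words n.+1 =
  [seq x :: w | x <- [:: (false,false); (false,true); (true,false); (true,true)],
                w <- words n].
Proof. by []. Qed.

Lemma size_words n w : w \in words n -> size w = n.
Proof.
elim: n w => [w|n IH w]; first by rewrite inE => /eqP ->.
by rewrite words_succ => /allpairsP[[x u] [_ /IH /= <- ->]].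
Qed.

Lemma mem_words w : w \in words (size w).
Proof.
elim: w => // x w IH; rewrite [size _]/= words_succ; apply/allpairsP.
by exists (x, w); split=> //=; case: x => [[] []].
Qed.

Lemma words_uniq n : uniq (words n).
Proof.
elim: n => // n IH; rewrite words_succ; apply: allpairs_uniq => //.
by move=> [x u] [y v] _ _ /= [-> ->].
Qed.

Lemma mem_ball n w : (w \in ball n) = reduced w && (size w <= n)%N.
Proof.
rewrite mem_filter; congr (_ && _); apply/flatten_mapP/idP => [[k]|wn].
  by rewrite mem_iota add0n ltnS => kn /size_words ->.
by exists (size w); rewrite ?mem_words// mem_iota add0n ltnS.
Qed.

Lemma ball_uniq n : uniq (ball n).
Proof.
apply: filter_uniq; elim: n => [//|n IH].
have -> : flatten [seq words k | k <- iota 0 n.+2] =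
    flatten [seq words k | k <- iota 0 n.+1] ++ words n.+1.
  by rewrite -[n.+2]addn1 iotaD map_cat flatten_cat /= cats0.
rewrite cat_uniq IH words_uniq andbT; apply/hasPn => w /size_words sw.
apply/negP => /flatten_mapP[k]; rewrite mem_iota add0n ltnS => kn /size_words.
by rewrite sw => kE; rewrite -kE ltnn in kn.
Qed.

Lemma ball_reduced n : all reduced (ball n).
Proof. exact: filter_all. Qed.

(** * Hermitian forms on polynomials from kernels on nat *)

Section PolynomialForm.
Variables (C : numClosedFieldType) (K : nat -> nat -> C).

Definition pform (p q : {poly C}) : C :=
  \sum_(i < size p) \sum_(j < size q) (p`_i)^* * K i j * q`_j.

(** Coefficients beyond the size are 0. A common summation range is what makes the sesquilinearity
    proofs termwise. *)
Lemma pform_widen m n (p q : {poly C}) : (size p <= m)%N -> (size q <= n)%N ->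
  pform p q = \sum_(i < m) \sum_(j < n) (p`_i)^* * K i j * q`_j.
Proof.
move=> pm qn; rewrite /pform.
under eq_bigr => i _ do rewrite (big_ord_widen n (fun j => (p`_i)^* * K i j * q`_j) qn) big_mkcond /=.
rewrite (big_ord_widen m
  (fun i => \sum_(j < n) if (j < size q)%N then (p`_i)^* * K i j * q`_j else 0) pm).
rewrite big_mkcond /=; apply: eq_bigr => i _.
case: ltnP => ip; last by rewrite big1 // => j _; rewrite nth_default ?conjC0 ?mul0r.
by apply: eq_bigr => j _; case: ltnP => // jq; rewrite [q`_j]nth_default ?mulr0.
Qed.

Lemma pformDl p q u : pform (p + q) u = pform p u + pform q u.
Proof.
pose m := maxn (size p) (size q).
have pm : (size p <= m)%N by rewrite leq_maxl.
have qm : (size q <= m)%N by rewrite leq_maxr.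
rewrite (pform_widen m (size u) (p + q)) ?(leq_trans (size_polyD _ _))//.
rewrite (pform_widen m (size u) p)// (pform_widen m (size u) q)//.
rewrite -big_split; apply: eq_bigr => i _; rewrite -big_split; apply: eq_bigr => j _.
by rewrite /= coefD rmorphD /= !mulrDl.
Qed.

Lemma pformDr p q u : pform u (p + q) = pform u p + pform u q.
Proof.
pose m := maxn (size p) (size q).
have pm : (size p <= m)%N by rewrite leq_maxl.
have qm : (size q <= m)%N by rewrite leq_maxr.
rewrite (pform_widen (size u) m _ (p + q)) ?(leq_trans (size_polyD _ _))//.
rewrite (pform_widen (size u) m _ p)// (pform_widen (size u) m _ q)//.
rewrite -big_split; apply: eq_bigr => i _; rewrite -big_split; apply: eq_bigr => j _.
by rewrite /= coefD mulrDr.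
Qed.

Lemma pformZl c p u : pform (c *: p) u = c^* * pform p u.
Proof.
rewrite (pform_widen (size p) (size u)) ?size_scale_leq// mulr_sumr.
apply: eq_bigr => i _; rewrite mulr_sumr; apply: eq_bigr => j _.
by rewrite coefZ rmorphM /= !mulrA.
Qed.

Lemma pformZr c p u : pform u (c *: p) = c * pform u p.
Proof.
rewrite (pform_widen (size u) (size p)) ?size_scale_leq// mulr_sumr.
apply: eq_bigr => i _; rewrite mulr_sumr; apply: eq_bigr => j _.
by rewrite coefZ mulrCA.
Qed.

Lemma pform0l u : pform 0 u = 0.
Proof. by rewrite /pform size_poly0 big_ord0. Qed.

Lemma pform0r u : pform u 0 = 0.
Proof. by rewrite /pform size_poly0 big1 // => i _; rewrite big_ord0. Qed.

Lemma pform_suml (I : Type) (s : seq I) (F : I -> {poly C}) u :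
  pform (\sum_(i <- s) F i) u = \sum_(i <- s) pform (F i) u.
Proof.
by apply: (big_morph (pform^~ u)) => [p q|]; rewrite ?pformDl ?pform0l.
Qed.

Lemma pform_sumr (I : Type) (s : seq I) (F : I -> {poly C}) u :
  pform u (\sum_(i <- s) F i) = \sum_(i <- s) pform u (F i).
Proof. by apply: (big_morph (pform u)) => [p q|]; rewrite ?pformDr ?pform0r. Qed.

Hypothesis K_shift : forall i j, K i.+1 j.+1 = K i j.

Lemma pformXX p q : pform ('X * p) ('X * q) = pform p q.
Proof.
have sX (u : {poly C}) : (size ('X * u)%R <= (size u).+1)%N.
  by rewrite (leq_trans (size_polyMleq _ _)) // size_polyX.
rewrite (pform_widen (size p).+1 (size q).+1) // big_ord_recl big1 ?add0r.
  apply: eq_bigr => i _; rewrite big_ord_recl coefXM /= coefXM /= mulr0 add0r.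
  by apply: eq_bigr => j _; rewrite coefXM /= /bump /= !add1n K_shift.
by move=> j _; rewrite coefXM /= conjC0 !mul0r.
Qed.

Lemma pformXnXn n p q : pform ('X^n * p) ('X^n * q) = pform p q.
Proof. by elim: n => [|n IH]; rewrite ?expr0 ?mul1r // exprS -!mulrA pformXX. Qed.

End PolynomialForm.

Arguments pform {C}.

(** * Shift-invariant positive forms and roots of unity *)

(** Positive semidefinite Toeplitz kernels, that is, moments of measures on the unit circle. They
    arise from positive definite functions on F by restriction to the powers of [a]. *)
Definition shift_pd {C : numClosedFieldType} (K : nat -> nat -> C) : Prop :=
  (forall i j, K i.+1 j.+1 = K i j) /\ (forall p, 0 <= pform K p p).

Section ShiftPD.
Variable C : numClosedFieldType.
Implicit Types (K : nat -> nat -> C) (p q u : {poly C}).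

Lemma pform_scale K c p : pform K (c *: p) (c *: p) = c^* * c * pform K p p.
Proof. by rewrite pformZl pformZr mulrA. Qed.

Lemma pform_parallelogram K p q : shift_pd K ->
  pform K (p + q) (p + q) <= 2 * pform K p p + 2 * pform K q q.
Proof.
move=> [_ posK]; rewrite -subr_ge0; apply: le_trans (posK (p - q)) _.
rewrite le_eqVlt; apply/orP; left; apply/eqP.
rewrite -[- q]scaleN1r !(pformDl, pformDr, pformZl, pformZr) rmorphN1.
by ring.
Qed.

Lemma conjM_ge0 (c : C) : 0 <= c^* * c.
Proof. by rewrite mulrC mul_conjC_ge0. Qed.

(** Horner's scheme: ['X] acts isometrically, and each coefficient costs one parallelogram
    inequality. What matters is that [D] depends on [q] alone, not on the kernel. *)
Lemma pform_mul_bound q : exists2 D : C, 0 <= D &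
  forall K u, shift_pd K -> pform K (q * u) (q * u) <= D * pform K u u.
Proof.
elim/poly_ind: q => [|q c [D D0 IH]].
  by exists 0 => // K u _; rewrite !mul0r pform0l.
exists (2 * D + 2 * (c^* * c)) => [|K u hK].
  by apply: addr_ge0; apply: mulr_ge0; rewrite ?ler0n // conjM_ge0.
have -> : (q * 'X + c%:P) * u = 'X * (q * u) + c *: u.
  by rewrite mulrDl mul_polyC (mulrC q) mulrA.
apply: le_trans (pform_parallelogram _ _ _ hK) _.
rewrite pformXX; last exact: (proj1 hK).
rewrite pform_scale [leRHS]mulrDl -!mulrA lerD2r.
by rewrite ler_wpM2l ?ler0n // IH.
Qed.

(** A [2 ^ n]-th root of -1 has an order that divides [2 ^ n.+1] but not [2 ^ n]. *)
Lemma exists_prim_root_exp2 n : exists z : C, (2 ^ n.+1).-primitive_root z.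
Proof.
pose z : C := (2 ^ n).-root (-1).
have zn : z ^+ (2 ^ n) = -1 by rewrite /z rootCK // expn_gt0.
have z1 : z ^+ (2 ^ n.+1) = 1 by rewrite expnSr exprM zn sqrrN expr1n.
have [|m prim_m] := prim_order_exists _ z1; first by rewrite expn_gt0.
case/(dvdn_pfactor _ _ (isT : prime 2)) => k kn mE; exists z.
move: kn; rewrite leq_eqVlt => /predU1P[<-|kn]; first by rewrite -mE.
have : (m %| 2 ^ n)%N by rewrite mE dvdn_exp2l.
by rewrite (prim_order_dvd prim_m) zn eq_sym -subr_eq0 opprK -mulr2n pnatr_eq0.
Qed.

(** * Lagrange interpolation at the roots of unity *)

Section RootsOfUnity.
Variables (N : nat) (z : C).
Hypothesis prim_z : N.-primitive_root z.

Let N_gt0 : (0 < N)%N := prim_order_gt0 prim_z.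

Lemma prim_root_conj : z^* = z^-1.
Proof.
have nz : `|z| = 1.
  by apply/eqP; rewrite -(pexpr_eq1 N_gt0) // -normrX (prim_expr_order prim_z) normr1.
by rewrite invC_norm nz expr1n invr1 mul1r.
Qed.

Let z_neq0 : z != 0.
Proof.
apply/negP => /eqP z0; have := prim_expr_order prim_z.
by rewrite z0 expr0n eqn0Ngt N_gt0 => /eqP; rewrite eq_sym oner_eq0.
Qed.

Lemma sum_expr_unity (w : C) : w ^+ N = 1 -> w != 1 -> \sum_(k < N) w ^+ k = 0.
Proof.
move=> wN w1; apply/eqP; have /esym/eqP := subrX1 w N.
by rewrite wN subrr mulf_eq0 subr_eq0 (negbTE w1).
Qed.

Lemma prim_root_orthogonality (i j : 'I_N) :
  \sum_(k < N) (z ^+ (i * k)) * (z ^+ (j * k))^-1 = (i == j)%:R * N%:R.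
Proof.
under eq_bigr => k _ do rewrite !exprM -exprVn -exprMn.
have [->|ij] := eqVneq i j.
  rewrite divff ?expf_neq0 // mul1r.
  by under eq_bigr => k _ do rewrite expr1n; rewrite sumr_const card_ord.
rewrite mul0r sum_expr_unity //.
  by rewrite exprMn exprVn -!exprM ![(_ * N)%N]mulnC !exprM (prim_expr_order prim_z)
    !expr1n invr1 mulr1.
apply: contra ij => /eqP ij1.
have /eqP : z ^+ i = z ^+ j by rewrite -[LHS](divfK (expf_neq0 j z_neq0)) ij1 mul1r.
by rewrite (eq_prim_root_expr prim_z) !modn_small // => /eqP/val_inj->.
Qed.

(* The Lagrange interpolation polynomial of the [N]-th roots of unity that is
   [1] at [z ^+ k]. *)
Definition lagr (k : nat) : {poly C} :=
  \sum_(j < N) (N%:R^-1 * (z ^+ (j * k))^-1) *: 'X^j.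

Lemma lagr_horner k : (lagr k).[z ^+ k] = 1.
Proof.
rewrite horner_sum (eq_bigr (fun=> N%:R^-1)) => [|j _].
  by rewrite sumr_const card_ord -[RHS](@mulVf _ N%:R) ?pnatr_eq0 -?lt0n // mulr_natr.
by rewrite hornerZ hornerXn -exprM mulnC mulfVK // expf_neq0.
Qed.

(** After expansion, orthogonality leaves only the terms [i = j]; by shift invariance each of these
    [N] terms is [N%:R^-1] times the right-hand side. *)
Lemma lagr_parseval K p : shift_pd K ->
  \sum_(k < N) pform K (lagr k * p) (lagr k * p) = pform K p p.
Proof.
move=> [shK _].
have E (k : 'I_N) : pform K (lagr k * p) (lagr k * p) =
    \sum_(i < N) \sum_(j < N) N%:R^-1 ^+ 2 * (z ^+ (i * k) * (z ^+ (j * k))^-1) *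
       pform K ('X^i * p) ('X^j * p).
  rewrite mulr_suml pform_suml; apply: eq_bigr => i _.
  rewrite pform_sumr; apply: eq_bigr => j _.
  rewrite -!scalerAl pformZl pformZr rmorphM /= !fmorphV rmorphXn /=.
  by rewrite prim_root_conj conjC_nat exprVn invrK; ring.
under eq_bigr => k _ do rewrite E.
rewrite exchange_big /= (eq_bigr (fun=> N%:R^-1 * pform K p p)) => [|i _].
  rewrite sumr_const card_ord -mulrnAl -(mulr_natr N%:R^-1) mulVf ?mul1r //.
  by rewrite pnatr_eq0 -lt0n.
rewrite exchange_big /= (bigD1 i) //= [X in _ + X]big1 => [|j ji].
  rewrite addr0 -mulr_suml -mulr_sumr prim_root_orthogonality eqxx mul1r.
  rewrite pformXnXn // expr2 -[_ * _ * N%:R]mulrA mulVf ?mulr1 //.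
  by rewrite pnatr_eq0 -lt0n.
rewrite -mulr_suml -mulr_sumr prim_root_orthogonality eq_sym (negbTE ji).
by rewrite mul0r mulr0 mul0r.
Qed.

(** The summands equal [2 - z ^+ k - z^-1 ^+ k], and both geometric sums vanish. *)
Lemma sum_chord : (1 < N)%N ->
  \sum_(k < N) (1 - z ^+ k)^* * (1 - z ^+ k) = 2 * N%:R.
Proof.
move=> N1; have z1 : z != 1.
  by rewrite -[z]expr1 -(prim_order_dvd prim_z) dvdn1 (gtn_eqF N1).
rewrite (eq_bigr (fun k : 'I_N => 2 - z ^+ k - z^-1 ^+ k)) => [|k _].
  rewrite !sumrB sumr_const card_ord !sum_expr_unity ?subr0 ?mulr_natr //.
  - by rewrite exprVn (prim_expr_order prim_z) invr1.
  - by rewrite invr_eq1.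
  - exact: prim_expr_order.
rewrite rmorphB rmorph1 rmorphXn /= prim_root_conj mulrBl !mulrBr.
by rewrite -exprMn mulVf // expr1n; ring.
Qed.

(** At [z ^+ k] the polynomial [lagr k * (1 - 'X)] takes the value [1 - z ^+ k], so it differs from
    this constant by a multiple of ['X - (z ^+ k)%:P], whose form is small if [K] is concentrated
    there. *)
Lemma lagr_lower_bound k : exists2 D : C, 0 <= D & forall K, shift_pd K ->
  (1 - z ^+ k)^* * (1 - z ^+ k) * pform K 1 1 <=
  2 * pform K (lagr k * (1 - 'X)) (lagr k * (1 - 'X)) +
  D * pform K ('X - (z ^+ k)%:P) ('X - (z ^+ k)%:P).
Proof.
set c := 1 - z ^+ k; set w := z ^+ k.
have /factor_theorem[q qE] : root (c%:P - lagr k * (1 - 'X)) w.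
  by rewrite rootE !hornerE lagr_horner mul1r subrr.
have [D D0 HD] := pform_mul_bound q.
exists (2 * D) => [|K hK]; first by rewrite mulr_ge0 ?ler0n.
rewrite -pform_scale -[c *: 1]mul_polyC mulr1.
rewrite -(subrK (lagr k * (1 - 'X)) c%:P) qE addrC.
apply: le_trans (pform_parallelogram _ _ _ hK) _.
by rewrite lerD2l -mulrA ler_wpM2l ?ler0n // HD.
Qed.

(* [k] ranges over the characters [a |-> z ^+ k]; the form of [K k] is
   concentrated near [z ^+ k] with variance of order [e], and [K0] dominates all
   of them although its own variance at [1] is of order [e]. *)
Lemma spread_bound : (1 < N)%N -> exists2 D : C, 0 <= D &
  forall (K0 : nat -> nat -> C) (K : 'I_N -> nat -> nat -> C) (L e : C),
    shift_pd K0 -> (forall k, shift_pd (K k)) -> 0 <= L -> 0 <= e ->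
    (forall k p, pform (K k) p p <= L * pform K0 p p) ->
    pform K0 (1 - 'X) (1 - 'X) <= 4 * e ->
    (forall k, 1 <= 2 * pform (K k) 1 1) ->
    (forall k : 'I_N,
       pform (K k) ('X - (z ^+ k)%:P) ('X - (z ^+ k)%:P) <= 4 * e) ->
  2 * N%:R <= 16 * L * e + D * e.
Proof.
move=> N1; have /choice[D HD] : forall k : 'I_N, exists D : C, 0 <= D /\
    forall K, shift_pd K -> (1 - z ^+ k)^* * (1 - z ^+ k) * pform K 1 1 <=
      2 * pform K (lagr k * (1 - 'X)) (lagr k * (1 - 'X)) +
      D * pform K ('X - (z ^+ k)%:P) ('X - (z ^+ k)%:P).
  by move=> k; have [D] := lagr_lower_bound k; exists D.
(* The 8 is the factor 2 of the mass bound times the factor 4 of the variance bound. *)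
exists (8 * \sum_k D k) => [|K0 K L e hK0 hK L0 e0 dom var0 mass var].
  by rewrite mulr_ge0 ?ler0n // sumr_ge0 // => k _; have [] := HD k.
rewrite -sum_chord //.
pose p : {poly C} := 1 - 'X.
apply: (@le_trans _ _ (\sum_(k < N)
   (4 * L * pform K0 (lagr k * p) (lagr k * p) + 8 * D k * e))).
  apply: ler_sum => k _; have [D0 {}HD] := HD k.
  set c := _ * _; have c0 : 0 <= c by exact: conjM_ge0.
  apply: le_trans (ler_peMr c0 (mass k)) _.
  rewrite mulrCA; apply: le_trans (ler_wpM2l _ (HD _ (hK k))) _; first exact: ler0n.
  rewrite mulrDr lerD //.
    rewrite mulrA -natrM -mulrA ler_wpM2l ?ler0n //; exact: dom.
  rewrite -[8]/((2 * 4)%:R) natrM -!mulrA ler_wpM2l ?ler0n // mulrCA.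
  exact: ler_wpM2l.
rewrite big_split /= -mulr_sumr lagr_parseval // -mulr_suml -mulr_sumr.
by rewrite lerD // -[16]/((4 * 4)%:R) natrM -!mulrA ler_wpM2l ?ler0n // mulrCA ler_wpM2l.
Qed.

End RootsOfUnity.
End ShiftPD.

(** * Energies and powers of the first generator *)

Section Energies.
Variable R : realType.
Local Notation C := R[i].
Implicit Types (D : mfun R 1) (p : {poly C}) (S : seq word).

Definition apow_kernel D (i j : nat) : C := D (fmul (finv (apow i)) (apow j)) 0 0.

(** The coefficients of [p] placed on the powers of [a]; a word is such a power exactly when it
    equals [apow] of its own length. *)
Definition polyvec p (w : word) (_ : 'I_1) : C :=
  if w == apow (size w) then p`_(size w) else 0.

Lemma hform1 D S (alpha : word -> 'I_1 -> C) : hform D S alpha =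
  \sum_(g <- S) \sum_(h <- S)
     (alpha h 0)^* * D (fmul (finv h) g) 0 0 * alpha g 0.
Proof. by apply: eq_bigr => g _; apply: eq_bigr => h _; rewrite !big_ord1. Qed.

(** The summand [F] is left general so that the same reduction serves the inner and the outer sum of
    [hform]. *)
Lemma sum_polyvec p S (F : word -> C -> C) : uniq S ->
  (forall i, (i < size p)%N -> apow i \in S) -> (forall w, F w 0 = 0) ->
  \sum_(w <- S) F w (polyvec p w 0) = \sum_(i < size p) F (apow i) p`_i.
Proof.
move=> uS pS F0; pose T := [seq apow i | i <- iota 0 (size p)].
rewrite (bigID (mem T)) /= addrC big1 => [|w wT]; last first.
  rewrite /polyvec; case: eqP => [wE|]; rewrite ?F0 //.
  rewrite nth_default ?F0 // leqNgt; apply: contra wT => sw.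
  by rewrite wE map_f // mem_iota.
rewrite add0r -big_filter (perm_big T) /=; last first.
  apply: uniq_perm; rewrite ?filter_uniq ?(map_inj_uniq apow_inj) ?iota_uniq //.
  move=> w; rewrite mem_filter andb_idr // => /mapP[j].
  by rewrite mem_iota => jp ->; apply: pS.
rewrite big_map -[size p]subn0 big_mkord subn0; apply: eq_bigr => i _.
by rewrite /polyvec size_nseq eqxx.
Qed.

Lemma hform_polyvec D p S : uniq S ->
  (forall i, (i < size p)%N -> apow i \in S) ->
  hform D S (polyvec p) = pform (apow_kernel D) p p.
Proof.
move=> uS pS; rewrite hform1.
rewrite (sum_polyvec p S (fun g c => \sum_(h <- S)
   (polyvec p h 0)^* * D (fmul (finv h) g) 0 0 * c)) //; last first.
  by move=> w; rewrite big1 // => h _; rewrite mulr0.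
rewrite /pform [RHS]exchange_big /=; apply: eq_bigr => j _.
rewrite (sum_polyvec p S (fun h c =>
   c^* * D (fmul (finv h) (apow j)) 0 0 * p`_j)) // => w.
by rewrite conjC0 !mul0r.
Qed.

Lemma apow_in_ball n i : (apow i \in ball n) = (i <= n)%N.
Proof. by rewrite mem_ball reduced_apow size_nseq. Qed.

Lemma hform_ball_polyvec D p n : (size p <= n.+1)%N ->
  hform D (ball n) (polyvec p) = pform (apow_kernel D) p p.
Proof.
move=> pn; apply: hform_polyvec (ball_uniq n) _ => i ip.
by rewrite apow_in_ball -ltnS (leq_trans ip).
Qed.

Lemma pd_full_shift_pd D : pd_full D -> shift_pd (apow_kernel D).
Proof.
move=> pdD; split=> [i j|p]; first by rewrite /apow_kernel fmul_finv_apowS.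
rewrite -(hform_ball_polyvec D p (size p)) //.
by apply: pdD; [exact: ball_uniq | exact: ball_reduced].
Qed.

Lemma ge0_ReE (x : C) : 0 <= x -> x = (complex.Re x)%:C%C.
Proof. by move=> /ger0_Im; case: x => a b /= ->. Qed.

Lemma energy_r_leP (A B : mfun R 1) r (L : R) alpha :
  (energy_r r A B <= L%:E)%E ->
  0 <= hform A (ball r./2) alpha -> 0 <= hform B (ball r./2) alpha ->
  hform B (ball r./2) alpha <= L%:C%C * hform A (ball r./2) alpha.
Proof.
move=> /ereal_supP leL.
have := leL _ (or_intror (ex_intro _ alpha _)).
move=> {}leL A0 B0; rewrite (ge0_ReE _ A0) (ge0_ReE _ B0) -rmorphM lecR.
move: leL A0 B0; set a := hform A _ _; set b := hform B _ _.
rewrite !lecE => leL /andP[_ /= A0] _.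
move: A0; rewrite le_eqVlt => /predU1P[qa0|qa_gt0].
  (* Degenerate case: a vector of zero [A]-norm and positive [B]-norm would put [+oo] into the
     set. *)
  rewrite -qa0 mulr0 leNgt; apply/negP => qb.
  by have := leL _ (or_intror (conj (esym qa0) (conj qb erefl))).
have := leL _ (or_introl (conj qa_gt0 erefl)).
by rewrite lee_fin ler_pdivrMr.
Qed.

Lemma energy_r_lub (A B : mfun R 1) r (L : R) : 0 <= L ->
  (forall alpha, 0 <= hform A (ball r./2) alpha) ->
  (forall alpha, hform B (ball r./2) alpha <= L%:C%C * hform A (ball r./2) alpha) ->
  (energy_r r A B <= L%:E)%E.
Proof.
move=> L0 A0 leB; apply/ereal_supP => x [->|[alpha]]; first by rewrite lee_fin.
move: (leB alpha); rewrite (ge0_ReE _ (A0 alpha)) -rmorphM lecE /= => /andP[_].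
set a := complex.Re _; set b := complex.Re _ => ba /=.
case=> [[a0 ->]|[a0 [b0 _]]]; first by rewrite lee_fin ler_pdivrMr.
by move: ba; rewrite a0 mulr0 leNgt b0.
Qed.

(** The full energy is a supremum over all radii, hence controls polynomials of every degree. The
    radius is twice [size p] because [energy_r] works on the ball of half the radius. *)
Lemma energy_full_leP (A B : mfun R 1) (L : R) p :
  pd_full A -> pd_full B -> (energy_full A B <= L%:E)%E ->
  pform (apow_kernel B) p p <= L%:C%C * pform (apow_kernel A) p p.
Proof.
move=> pdA pdB leL; have sp : (size p <= (size p).+1)%N by [].
rewrite -!(hform_ball_polyvec _ p (size p)) // -[size p]doubleK.
have ub : uniq (ball (size p).*2./2) := ball_uniq _.
have rb : all reduced (ball (size p).*2./2) := ball_reduced _.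
apply: energy_r_leP; rewrite ?pdA ?pdB //.
by apply: le_trans leL; apply: ereal_sup_ubound; exists (size p).*2.
Qed.

End Energies.

Arguments apow_kernel {R}.

(** * Perturbed characters *)

Section Characters.
Variables (R : realType) (z : R[i]).
Local Notation C := R[i].
Hypothesis z_unitary : z^* * z = 1.

Definition chi_letter (z : C) (x : letter) : C :=
  if x.1 then 1 else if x.2 then z^* else z.

Definition chi (z : C) (w : word) : C := \prod_(x <- w) chi_letter z x.

Lemma chi_letter_inv x : chi_letter z (inv_letter x) = (chi_letter z x)^*.
Proof. by case: x => [[] []]; rewrite /chi_letter /= ?conjC1 ?conjCK. Qed.

Lemma chi_letter_unitary x : (chi_letter z x)^* * chi_letter z x = 1.
Proof.
by case: x => [[] []]; rewrite /chi_letter /= ?conjC1 ?mulr1 ?conjCK // mulrC.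
Qed.

Lemma chi_red_cons x w : chi z (red_cons x w) = chi_letter z x * chi z w.
Proof.
rewrite /chi; case: w => [|y w] /=; first by rewrite big_cons.
case: eqP => [->|_]; last by rewrite big_cons.
by rewrite big_cons chi_letter_inv mulrA [_ * _^*]mulrC chi_letter_unitary mul1r.
Qed.

Lemma chi_fmul u v : chi z (fmul u v) = chi z u * chi z v.
Proof.
elim: u => [|x u IH]; first by rewrite /chi big_nil mul1r.
by rewrite [fmul _ _]/= chi_red_cons IH mulrA /chi big_cons.
Qed.

Lemma chi_finv w : chi z (finv w) = (chi z w)^*.
Proof.
rewrite /chi /finv big_rev /= big_map rmorph_prod /=.
by apply: eq_bigr => x _; rewrite chi_letter_inv.
Qed.

Lemma chi_unitary w : (chi z w)^* * chi z w = 1.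
Proof.
rewrite /chi rmorph_prod -big_split big1 // => x _ /=.
exact: chi_letter_unitary.
Qed.

Lemma chi_apow i : chi z (apow i) = z ^+ i.
Proof.
by rewrite /chi; elim: i => [|i IH]; rewrite ?big_nil // big_cons IH exprS.
Qed.

End Characters.

Arguments chi {R}.

(** * Two-sided bounds for perturbed characters *)

Section Configuration.
Variables (R : realType) (h : R).
Local Notation C := R[i].
Local Notation e := (h%:C%C).
Hypotheses (h_gt0 : 0 < h) (h_le1 : h <= 1).

Definition pert (z : C) : mfun R 1 :=
  fun w => ((1 - e) * chi z w + e * (w == [::])%:R)%:M.

Definition sqnorm (S : seq word) (alpha : word -> 'I_1 -> C) : C :=
  \sum_(g <- S) (alpha g 0)^* * alpha g 0.

Lemma sqnorm_ge0 S alpha : 0 <= sqnorm S alpha.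
Proof. by apply: sumr_ge0 => g _; rewrite conjM_ge0. Qed.

Let e_gt0 : 0 < e. Proof. by rewrite ltcR. Qed.
Let e_le1 : e <= 1. Proof. by rewrite lecR. Qed.

Variable z : C.
Hypothesis z_unitary : z^* * z = 1.

(** The form of a character has rank one, and the delta function at the identity contributes only
    the diagonal. *)
Lemma hform_pert S alpha : uniq S -> all reduced S ->
  hform (pert z) S alpha =
    (1 - e) * ((\sum_(g <- S) chi z g * alpha g 0)^* *
               (\sum_(g <- S) chi z g * alpha g 0)) + e * sqnorm S alpha.
Proof.
move=> uS /allP rS; rewrite hform1 rmorph_sum /= mulr_sumr mulr_sumr.
rewrite /sqnorm mulr_sumr -big_split /= big_seq [RHS]big_seq.
apply: eq_bigr => g gS; rewrite mulr_suml mulr_sumr.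
rewrite (bigD1_seq g gS uS) /= [in RHS](bigD1_seq g gS uS) /=.
rewrite addrAC; congr (_ + _).
  rewrite !mxE mulr1n chi_fmul // chi_finv // fmul_finv_id eqxx rmorphM /=.
  by ring.
rewrite big_seq_cond [RHS]big_seq_cond; apply: eq_bigr => k /andP[kS kg].
rewrite !mxE mulr1n chi_fmul // chi_finv // fmul_finv_eq1 ?rS //.
by rewrite eq_sym (negbTE kg) rmorphM /=; ring.
Qed.

Lemma hform_pert_ge S alpha : uniq S -> all reduced S ->
  e * sqnorm S alpha <= hform (pert z) S alpha.
Proof.
move=> uS rS; rewrite hform_pert // lerDr mulr_ge0 ?conjM_ge0 //.
by rewrite subr_ge0.
Qed.

Lemma hform_pert_ge0 S alpha : uniq S -> all reduced S ->
  0 <= hform (pert z) S alpha.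
Proof.
move=> uS rS; apply: le_trans (hform_pert_ge _ _ uS rS).
by rewrite mulr_ge0 ?sqnorm_ge0 // ltW.
Qed.

(** A crude Cauchy-Schwarz inequality: one use of the parallelogram law per element, each doubling
    the constant. *)
Lemma sqr_sum_le (S : seq word) (F : word -> C) :
  (\sum_(g <- S) F g)^* * (\sum_(g <- S) F g) <=
  (2 ^ size S)%:R * \sum_(g <- S) (F g)^* * F g.
Proof.
elim: S => [|g S IH]; first by rewrite !big_nil mulr0 mulr0.
rewrite !big_cons; set x := F g; set y := \sum_(g <- S) F g.
have xy : (x + y)^* * (x + y) <= 2 * (x^* * x) + 2 * (y^* * y).
  rewrite -subr_ge0 (_ : _ - _ = (x - y)^* * (x - y)) ?conjM_ge0 //.
  by rewrite rmorphD rmorphB /=; ring.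
apply: le_trans xy _; rewrite mulrDr expnS natrM lerD //.
  by rewrite -mulrA ler_wpM2l ?ler0n // ler_peMl ?conjM_ge0 // ler1n expn_gt0.
by rewrite -mulrA ler_wpM2l ?ler0n.
Qed.

Lemma hform_pert_le S alpha : uniq S -> all reduced S ->
  hform (pert z) S alpha <= (2 ^ size S)%:R * sqnorm S alpha.
Proof.
move=> uS rS; rewrite hform_pert //.
have := sqr_sum_le S (fun g => chi z g * alpha g 0).
rewrite [X in _ <= _ * X -> _](_ : _ = sqnorm S alpha); last first.
  apply: eq_bigr => g _.
  by rewrite rmorphM /= mulrACA chi_unitary // mul1r.
set s := _^* * _ => sle.
(* The bound is split with weights [1 - e] and [e], to be compared with the character part and the
   delta part separately. *)
rewrite [leRHS](_ : _ = (1 - e) * ((2 ^ size S)%:R * sqnorm S alpha) +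
  e * ((2 ^ size S)%:R * sqnorm S alpha)) ?lerD //; last by ring.
  by rewrite ler_wpM2l // subr_ge0.
by rewrite ler_wpM2l ?(ltW e_gt0) // ler_peMl ?sqnorm_ge0 // ler1n expn_gt0.
Qed.

Lemma pert_nspd r : nspd r (pert z).
Proof.
split; first by rewrite /pert /chi big_nil eqxx !mulr1 subrK.
split=> [S alpha [uS [rS _]]|S alpha [uS [rS _]] f0 g gS j].
  exact: hform_pert_ge0.
(* Strictness comes from the delta part: the form is at least [e * sqnorm S alpha] with [e]
   positive. *)
have n0 : sqnorm S alpha = 0.
  apply/eqP; rewrite eq_le sqnorm_ge0 andbT -(ler_pM2l e_gt0) mulr0 -f0.
  exact: hform_pert_ge.
move/eqP: n0; rewrite psumr_eq0 => [/allP/(_ g gS)|k _]; last exact: conjM_ge0.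
by rewrite mulrC /= mul_conjC_eq0 ord1 => /eqP.
Qed.

Lemma pform_pert p : pform (apow_kernel (pert z)) p p =
  (1 - e) * (p.[z]^* * p.[z]) + e * \sum_(i < size p) (p`_i)^* * p`_i.
Proof.
rewrite -(hform_ball_polyvec _ _ p (size p)) // hform_pert ?ball_uniq ?ball_reduced //.
have pB i : (i < size p)%N -> apow i \in ball (size p).
  by rewrite apow_in_ball => /ltnW.
rewrite /sqnorm (sum_polyvec _ p (ball (size p)) (fun g c => c^* * c)) ?ball_uniq //; last first.
  by move=> w; rewrite mulr0.
rewrite (sum_polyvec _ p (ball (size p)) (fun g c => chi z g * c)) ?ball_uniq //; last first.
  by move=> w; rewrite mulr0.
rewrite (_ : \sum_(i < size p) chi z (apow i) * _ = p.[z]) //.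
by rewrite horner_coef; apply: eq_bigr => i _; rewrite chi_apow mulrC.
Qed.

Lemma pform_pert1 : pform (apow_kernel (pert z)) 1 1 = 1.
Proof.
rewrite pform_pert hornerC size_poly1 big_ord1 coefC /= conjC1 !mulr1.
by rewrite subrK.
Qed.

(** The character part vanishes because [z] is a root; the delta part sees two coefficients of
    modulus 1. *)
Lemma pform_pertXsubC :
  pform (apow_kernel (pert z)) ('X - z%:P) ('X - z%:P) = 2 * e.
Proof.
rewrite pform_pert hornerXsubC subrr !mulr0 add0r size_XsubC.
rewrite big_ord_recl big_ord1 !coefB !coefX !coefC /= sub0r subr0 conjC1 mul1r.
by rewrite rmorphN mulrNN z_unitary mulrC.
Qed.

End Configuration.

Arguments pert {R}.

Section ConfigurationEnergy.
Variables (R : realType) (h : R).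
Hypotheses (h_gt0 : 0 < h) (h_le1 : h <= 1).

(** Here 32 is [2 ^ 5], from the five elements of the ball of radius 1, and [h] is the lower bound
    of the form relative to [sqnorm]. *)
Lemma energy_pert (z w : R[i]) : z^* * z = 1 -> w^* * w = 1 ->
  (energy_r 2 (pert h z) (pert h w) <= (32 / h)%:E)%E.
Proof.
move=> z1 w1; have ub := ball_uniq 1; have rb := ball_reduced 1.
apply: energy_r_lub => [|alpha|alpha]; first by rewrite divr_ge0 ?ltW.
  exact: hform_pert_ge0.
apply: le_trans (hform_pert_le _ _ h_gt0 h_le1 _ w1 _ alpha ub rb) _.
rewrite (_ : size (ball 1) = 5) //.
apply: le_trans (ler_wpM2l _ (hform_pert_ge _ _ h_le1 _ z1 _ alpha ub rb)); last first.
  by rewrite ler0c divr_ge0 ?ltW.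
by rewrite mulrA -rmorphM divfK ?gt_eqF // rmorph_nat.
Qed.

Lemma energy_pert_refl (z : R[i]) : z^* * z = 1 ->
  (energy_r 2 (pert h z) (pert h z) <= 1%:E)%E.
Proof.
move=> z1; apply: energy_r_lub => [//|alpha|alpha]; last by rewrite rmorph1 mul1r.
exact: hform_pert_ge0.
Qed.

End ConfigurationEnergy.

(** * The prism graph *)

(* The cycle [(false, _)] will carry copies of a single function: extensions can
   only decrease along it, so it acts as one vertex of large degree. *)
Definition prism (n : nat) : rel (bool * 'I_n) := fun u v =>
  (v == (u.1, ordS u.2)) || (v == (~~ u.1, u.2)).

Lemma prism_four_regular n : four_regular (prism n).
Proof.
move=> v.
have out : [set w | prism n v w] =i pred2 (v.1, ordS v.2) (~~ v.1, v.2).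
  by move=> w; rewrite -[LHS]/(`[< prism n v w >]) asboolb.
have inn : [set u | prism n u v] =i pred2 (v.1, ord_pred v.2) (~~ v.1, v.2).
  move=> u; rewrite -[LHS]/(`[< prism n u v >]) asboolb /prism !inE.
  case: u v {out} => [b i] [c j] /=; rewrite !xpair_eqE; congr (_ || _).
    by rewrite eq_sym; congr (_ && _); apply/eqP/eqP => ->; rewrite ?ordSK ?ord_predK.
  by rewrite [j == i]eq_sym; case: b c => [] [].
(* The two neighbours of each kind have different first coordinates, so they are distinct even on a
   cycle of length 1. *)
rewrite (eq_card out) (eq_card inn) !card2 !xpair_eqE.
by case: (v.1).
Qed.

Lemma lipschitz_energy (R : realType) (x y : \bar R) (M c : R) : 0 <= M ->
  (x - 1%E <= M%:E * (y - 1%E))%E -> (y <= c%:E)%E ->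
  (x <= (1 + M * (c - 1))%:E)%E.
Proof.
move=> M0 xy yc; rewrite addrC EFinD -leeBlDr //; apply: le_trans xy _.
by rewrite EFinM lee_wpmul2l ?lee_fin // EFinB leeB.
Qed.

(** * Extensions of the configuration on the prism *)

Section PrismCost.
Variables (R : realType) (n : nat) (z : R[i]) (h : R).
Local Notation C := R[i].
Local Notation N := (2 ^ n.+1)%N.
Hypothesis prim_z : N.-primitive_root z.
Hypotheses (h_gt0 : 0 < h) (h_le1 : h <= 1).

Definition prism_conf (v : bool * 'I_N) : mfun R 1 :=
  pert h (if v.1 then z ^+ v.2 else 1).

Lemma prism_conf_unitary (b : bool) k :
  (if b then z ^+ k else 1)^* * (if b then z ^+ k else 1) = 1 :> C.
Proof.
case: b; last by rewrite conjC1 mulr1.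
rewrite rmorphXn /= (prim_root_conj _ _ _ prim_z) -exprMn mulVf ?expr1n //.
apply/negP => /eqP z0; have := prim_expr_order prim_z.
by rewrite z0 expr0n eqn0Ngt expn_gt0 => /eqP; rewrite eq_sym oner_eq0.
Qed.

(** Radius 2 means realizations on the ball of radius 1, hence the restriction to polynomials of
    degree at most 1. *)
Lemma energy_2_leP (A B : mfun R 1) (L : R) (p : {poly C}) :
  (energy_r 2 A B <= L%:E)%E ->
  (forall alpha, 0 <= hform A (ball 1) alpha) ->
  (forall alpha, 0 <= hform B (ball 1) alpha) -> (size p <= 2)%N ->
  pform (apow_kernel B) p p <= L%:C%C * pform (apow_kernel A) p p.
Proof.
move=> AB A0 B0 p2; rewrite -!(hform_ball_polyvec _ _ _ 1) //.
by apply: (energy_r_leP _ _ _ 2).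
Qed.

Section Extension.
Variables (M : R) (Chat : bool * 'I_N -> mfun R 1).
Hypotheses (M_ge1 : 1 <= M) (pd_Chat : forall v, pd_full (Chat v)).
Hypothesis near : forall v,
  (energy_r 2 (prism_conf v) (Chat v) <= (1 + 1)%:E /\
   energy_r 2 (Chat v) (prism_conf v) <= (1 + 1)%:E)%E.
Hypothesis lipschitz : forall v w, prism N v w ->
  (energy_full (Chat v) (Chat w) - 1%E <=
   M%:E * (energy_r 2 (prism_conf v) (prism_conf w) - 1%E))%E.

Local Notation Q v := (pform (apow_kernel (Chat v))).
Let M_ge0 : 0 <= M := le_trans ler01 M_ge1.

Let Chat_ge0 v alpha : 0 <= hform (Chat v) (ball 1) alpha.
Proof. by apply: pd_Chat; [exact: ball_uniq | exact: ball_reduced]. Qed.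

Let conf_ge0 v alpha : 0 <= hform (prism_conf v) (ball 1) alpha.
Proof.
by apply: hform_pert_ge0 => //; exact: prism_conf_unitary.
Qed.

(** Both ends of the edge carry the same function, of relative energy at most 1, so the allowed
    excess is 0 whatever [M] is. *)
Lemma Chat_cycle (i : 'I_N) p : Q (false, ordS i) p p <= Q (false, i) p p.
Proof.
have edge : prism N (false, i) (false, ordS i) by rewrite /prism eqxx.
have := lipschitz_energy _ _ _ _ _ M_ge0 (lipschitz _ _ edge)
  (energy_pert_refl _ _ h_gt0 h_le1 _ (prism_conf_unitary false 0)).
rewrite subrr mulr0 addr0 => /(energy_full_leP _ _ _ _ p (pd_Chat _) (pd_Chat _)).
by rewrite rmorph1 mul1r.
Qed.

Lemma Chat_path (o i : 'I_N) p : o = 0%N :> nat -> Q (false, i) p p <= Q (false, o) p p.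
Proof.
move=> o0; case: i => i; elim: i => [|i IH] iN.
  by rewrite (_ : Ordinal iN = o) //; exact: val_inj.
apply: le_trans (IH (ltnW iN)); rewrite (_ : Ordinal iN = ordS (Ordinal (ltnW iN))).
  exact: Chat_cycle.
(* The path from 0 does not wrap around, as [i.+1 < N]. *)
by apply: val_inj; rewrite /= modn_small.
Qed.

Lemma Chat_match (o i : 'I_N) p : o = 0%N :> nat ->
  Q (true, i) p p <= (32 * M / h)%:C%C * Q (false, o) p p.
Proof.
move=> o0; have edge : prism N (false, i) (true, i) by rewrite /prism eqxx orbT.
have := lipschitz_energy _ _ _ _ _ M_ge0 (lipschitz _ _ edge)
  (energy_pert _ _ h_gt0 h_le1 _ _ (prism_conf_unitary false 0)
                                   (prism_conf_unitary true i)).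
move=> /(energy_full_leP _ _ _ _ p (pd_Chat _) (pd_Chat _)) /le_trans; apply.
have [_ Q0] := pd_full_shift_pd _ _ (pd_Chat (false, i)).
apply: (@le_trans _ _ ((32 * M / h)%:C%C * Q (false, i) p p)).
  (* The constant [1 + M * (32 / h - 1)] equals [32 * M / h + (1 - M)], and [M] is at least 1. *)
  rewrite ler_wpM2r // lecR mulrBr mulr1 addrCA.
  by rewrite mulrA (mulrC M) gerDl subr_le0.
rewrite ler_wpM2l ?Chat_path // ler0c.
by rewrite divr_ge0 ?mulr_ge0 ?(ltW h_gt0).
Qed.

(** With [eps = 1] the extension and the original differ by a factor of at most [1 + eps = 2], and
    the original has mass 1. *)
Lemma Chat_mass v : 1 <= 2 * Q v 1 1.
Proof.
have := energy_2_leP _ _ _ 1 (proj2 (near v)) (Chat_ge0 v) (conf_ge0 v).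
by rewrite pform_pert1 ?prism_conf_unitary // rmorphD rmorph1 size_poly1; apply.
Qed.

Lemma Chat_variance (v : bool * 'I_N) (w := if v.1 then z ^+ v.2 else 1) :
  Q v ('X - w%:P) ('X - w%:P) <= 4 * h%:C%C.
Proof.
have := energy_2_leP _ _ _ ('X - w%:P) (proj1 (near v)) (conf_ge0 v) (Chat_ge0 v).
rewrite pform_pertXsubC ?prism_conf_unitary // rmorphD rmorph1 size_XsubC.
by rewrite (_ : (1 + 1) * _ = 4 * h%:C%C); [apply | ring].
Qed.

End Extension.

End PrismCost.


(** * Lower bounds for the cost *)

Lemma encost_prism_unbounded (R : realType) (n : nat) :
  (((2 ^ n.+1)%:R / 512 : R)%:E <=
    encost_graph (prism (2 ^ n.+1)) 2 (1 : R))%E.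
Proof.
set N := (2 ^ n.+1)%N.
have [z prim_z] := exists_prim_root_exp2 R[i] n.
have N1 : (1 < N)%N by rewrite /N -[1%N](expn0 2) ltn_exp2l.
have [D D0 spread] := spread_bound _ _ _ prim_z N1.
pose d := complex.Re D; have DE : D = d%:C%C := ge0_ReE _ _ D0.
have d0 : 0 <= d by move: D0; rewrite DE ler0c.
(* Since [D] depends only on [N] and [z], the perturbation can be chosen after it, so small that the
   error [d * h] is at most 1. *)
pose h := (1 + d)^-1.
have h_gt0 : 0 < h by rewrite invr_gt0 ltr_wpDr.
have h_le1 : h <= 1 by rewrite invf_le1 ?lerDl // ltr_wpDr.
have dh1 : d * h <= 1 by rewrite ler_pdivrMr ?ltr_wpDr // mul1r lerDr.
pose o : 'I_N := Ordinal (ltnW N1).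
pose Cs := prism_conf R n z h.
apply: (@le_trans _ _ (encost (prism N) 2 1 Cs)); last first.
  apply: ereal_sup_ubound; exists 1%N, Cs; split=> // v.
  exact: pert_nspd (prism_conf_unitary _ _ _ prim_z _ _) _.
apply/ereal_infP => _ [M [M1 [Chat [pdC [near lip]]]] <-]; rewrite lee_fin.
have M0 : 0 <= M by exact: le_trans M1.
have L0 : 0 <= 32 * M / h by rewrite divr_ge0 ?mulr_ge0 ?(ltW h_gt0).
have pdK v := pd_full_shift_pd _ _ (pdC v).
have := spread _ (fun k => apow_kernel (Chat (true, k))) (32 * M / h)%:C%C h%:C%C
  (pdK (false, o)) (fun k => pdK (true, k)).
rewrite !ler0c => /(_ L0 (ltW h_gt0)) bound.
have {}bound : 2 * N%:R <= 16 * (32 * M / h)%:C%C * h%:C%C + D * h%:C%C.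
  apply: bound => [k p||k|k].
  - exact: Chat_match prim_z h_gt0 h_le1 _ _ M1 pdC lip _ _ _ _.
  (* At the vertex [(false, o)] the concentration point is 1, and [1 - 'X] is the polynomial of
     [Chat_variance] up to sign. *)
  - have := Chat_variance _ _ _ _ prim_z h_gt0 h_le1 _ pdC near (false, o).
    by rewrite -[1 - 'X]opprB -scaleN1r pform_scale rmorphN1 mulrNN !mul1r; apply.
  - exact: Chat_mass prim_z h_gt0 h_le1 _ pdC near _.
  - exact: Chat_variance prim_z h_gt0 h_le1 _ pdC near (true, k).
have lh : 32 * M / h * h = 32 * M by rewrite divfK // gt_eqF.
move: bound lh L0; move: (32 * M / h) => l bound lh L0.
have : ((2 * N%:R : R)%:C <= (16 * l * h + d * h)%:C)%C.
  by rewrite rmorphD !rmorphM !rmorph_nat /= -DE.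
rewrite lecR -mulrA lh => {}bound.
(* The factor [h] has cancelled, leaving [2 * N <= 512 * M + 1], where 512 is [16 * 32]; the 1 is
   absorbed using [1 <= M]. *)
by rewrite ler_pdivrMr ?ltr0n //; lra.
Qed.

Lemma four_regular_unbounded (R : realType) :
  ereal_sup [set x | exists (V : finType) (E : rel V),
    four_regular E /\ x = encost_graph E 2 (1 : R)] = +oo%E.
Proof.
apply/eqyP => A A0; pose n := Num.bound (A * 512).
apply: (@le_trans _ _ ((2 ^ n.+1)%:R / 512 : R)%:E).
  rewrite lee_fin ler_pdivlMr ?ltr0n //; apply: ltW.
  apply: lt_le_trans (archi_boundP (mulr_ge0 (ltW A0) (ler0n _ _))) _.
  by rewrite ler_nat -/n ltnW // (ltn_trans (ltnSn n)) // ltn_expl.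
apply: le_trans (encost_prism_unbounded R n) _; apply: ereal_sup_ubound.
exists (bool * 'I_(2 ^ n.+1))%type, (prism (2 ^ n.+1)); split=> //.
exact: prism_four_regular.
Qed.

Theorem theorem2 (R : realType) :
  exists (r : nat) (eps : R), 0 < eps /\
    encost_F r eps = +oo%E /\
    ereal_sup [set x | exists (V : finType) (E : rel V),
                 four_regular E /\ x = encost_graph E r eps] = +oo%E.
Proof.
exists 2, 1; split; first exact: ltr01.
split; last exact: four_regular_unbounded.
(* The supremum over all finite graphs dominates the one over 4-regular graphs. *)
apply/eqP; rewrite -leye_eq -(four_regular_unbounded R).
apply: ereal_sup_le => _ [V [E [_ ->]]]; by exists V, E.
Qed.
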